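(* In general, $\mathcal{M}\neq\mathcal{V}\cap\Delta_{|S|^n-1}$ for homogeneous multistate Markov models. That is, there exist a finite set $S$ and integers $1\le k<n$ such that, for the homogeneous $k$-th order multistate Markov model on $S$ for paths of length $n$, one has $\mathcal{M}\ne\mathcal{V}\cap\Delta_{|S|^n-1}$.
   Context: The homogeneous $k$-th order model: parameters are real numbers $\pi_{i_1\ldots i_k}$ (for $(i_1,\dots,i_k)\in S^k$) and $a_{i_0i_1\cdots i_k}$ (for $(i_0,\dots,i_k)\in S^{k+1}$, not depending on time), and $\phi$ maps $(\pi,a)\in\mathbb{R}^{S^k}\times\mathbb{R}^{S^{k+1}}$ to the point of $\mathbb{R}^{S^n}$ with coordinates $$\phi_{i_1\ldots i_n}(\pi,a)=\pi_{i_1\ldots i_k}\prod_{\ell=k+1}^n a_{i_{\ell-k}\cdots i_{\ell-1}i_\ell},\qquad (i_1,\dots,i_n)\in S^n.$$ $\Theta$ is the set of $(\pi,a)$ with all entries nonnegative, $\sum_{i_1,\dots,i_k\in S}\pi_{i_1\ldots i_k}=1$, and $\sum_{i_k\in S}a_{i_0\cdots i_{k-1}i_k}=1$ for all $i_0,\dots,i_{k-1}\in S$. Then $\mathcal{M}=\phi(\Theta)$, $\mathcal{V}=\phi(\mathbb{R}^{S^k}\times\mathbb{R}^{S^{k+1}})$ is the image of all real parameters, and $\Delta_{|S|^n-1}\subset\mathbb{R}^{S^n}$ is the probability simplex of vectors with nonnegative entries summing to $1$. *)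

(* Defs.v *)
From HB Require Import structures.
From mathcomp Require Import all_boot all_order all_algebra.
From mathcomp Require Import classical_sets reals.

Set Implicit Arguments.
Unset Strict Implicit.
Unset Printing Implicit Defensive.

Import Order.TTheory GRing.Theory Num.Theory.

Local Open Scope classical_set_scope.
Local Open Scope ring_scope.

Lemma window_subproof (n k : nat) (j : 'I_(n - k)) (i : 'I_k.+1) :
  (j + i < n)%N.
Proof.
by rewrite addnC -ltn_subRL (leq_trans (ltn_ord j)) // leq_sub2l // -ltnS.
Qed.

Section HomogeneousMarkovModel.
Variables (R : realType) (S : finType) (k n : nat) (hkn : (k < n)%N).

(* Pairs (pi, a), where a is indexed by (i_0, ..., i_k). *)
Definition params : Type :=
  ({ffun k.-tuple S -> R} * {ffun k.+1.-tuple S -> R})%type.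

Definition initial (s : n.-tuple S) : k.-tuple S :=
  [tuple tnth s (widen_ord (ltnW hkn) i) | i < k].

(* Positions in s are numbered from 0: window s j is the block
   (i_{l-k}, ..., i_l) of s = (i_1, ..., i_n), with l = j + k + 1. *)
Definition window (s : n.-tuple S) (j : 'I_(n - k)) : k.+1.-tuple S :=
  [tuple tnth s (Ordinal (window_subproof j i)) | i < k.+1].

Definition phi (p : params) : {ffun n.-tuple S -> R} :=
  [ffun s => p.1 (initial s) * \prod_(j < n - k) p.2 (window s j)].

Definition Theta : set params :=
  [set p : params | [/\ forall t, 0 <= p.1 t,
               forall u, 0 <= p.2 u,
               \sum_(t : k.-tuple S) p.1 t = 1 &
               forall t : k.-tuple S,
                 \sum_(x : S) p.2 [tuple of rcons t x] = 1]].

Definition markov_model : set {ffun n.-tuple S -> R} := phi @` Theta.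

Definition markov_image : set {ffun n.-tuple S -> R} := range phi.

End HomogeneousMarkovModel.

Definition prob_simplex (R : realType) (T : finType) : set {ffun T -> R} :=
  [set q | (forall x, 0 <= q x) /\ \sum_(x : T) q x = 1].
Arguments prob_simplex : clear implicits.

Arguments markov_model R S {k n} hkn.
Arguments markov_image R S {k n} hkn.

(* Main.v *)
(** On two states with k = 1 and n = 3, consider the law giving mass 1/2 to each
    of the paths (0,0,0) and (0,0,1). It is the image of nonnegative parameters
    whose transition row out of state 1 vanishes. Under stochastic parameters,
    both paths having positive mass forces pi_0 a_01 <> 0; as the paths (0,1,0)
    and (0,1,1) have mass 0, the row out of state 1 vanishes and cannot sum
    to 1. *)
Require Import Defs.
From HB Require Import structures.
From mathcomp Require Import all_boot all_order all_algebra.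
From mathcomp Require Import classical_sets reals.

Import Order.TTheory GRing.Theory Num.Theory.

Local Open Scope classical_set_scope.
Local Open Scope ring_scope.

Lemma phi13E (R : realType) (S : finType) (p : params R S 1) (x y z : S) :
  phi (isT : (1 < 3)%N) p [tuple x; y; z] =
  p.1 [tuple x] * (p.2 [tuple x; y] * p.2 [tuple y; z]).
Proof.
rewrite ffunE; congr (p.1 _ * _).
  by apply: eq_from_tnth => i; rewrite tnth_mktuple (ord1 i).
(* The bound [3 - 1] is 2 only up to conversion, hence the explicit [1]. *)
rewrite (big_ord_recl 1) big_ord1; congr (p.2 _ * p.2 _);
  by apply: eq_from_tnth => -[[|[|//]] ?]; rewrite tnth_mktuple.
Qed.

(** Reduces the total mass of a law on paths of length 3 to finitely many explicit terms. *)
Lemma big_tuple3 (R : nmodType) (S : finType) (F : 3.-tuple S -> R) :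
  \sum_s F s = \sum_x \sum_y \sum_z F [tuple x; y; z].
Proof.
rewrite pair_bigA pair_bigA /=.
rewrite (reindex (fun u : S * S * S => [tuple u.1.1; u.1.2; u.2])) //=.
exists (fun s : 3.-tuple S => (tnth s 0, tnth s 1, tnth s 2%:R)).
  by move=> [[x y] z].
(* Both sides read [s] at the same position below 3; only the default values of [nth] differ. *)
by move=> s _; apply: eq_from_tnth => -[[|[|[|//]]] ?] /=;
  rewrite /tnth /=; apply: set_nth_default; rewrite size_tuple.
Qed.

Theorem proposition6p2 (R : realType) :
  exists (S : finType) (k n : nat) (hkn : (k < n)%N),
    (1 <= k)%N /\
    markov_model R S hkn
      <> markov_image R S hkn `&` prob_simplex R (n.-tuple S : finType).
Proof.
exists bool, 1%N, 3%N, isT; split=> // eqM.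
(* State 0 is [false]. Both transitions out of it have weight 1, so its row sums to 2, which the
   initial weight 1/2 offsets. *)
pose p : params R bool 1 :=
  ([ffun t => 2^-1 * (~~ thead t)%:R], [ffun u => (~~ thead u)%:R]).
have phipE x y z :
    phi (isT : (1 < 3)%N) p [tuple x; y; z] = 2^-1 * (~~ x && ~~ y)%:R.
  rewrite phi13E !ffunE !theadE.
  by case: x y => [] []; rewrite ?(mulr0, mul0r, mulr1).
have : markov_model R bool (isT : (1 < 3)%N) (phi (isT : (1 < 3)%N) p).
  rewrite eqM; split; first by exists p.
  split=> [s|].
    rewrite !ffunE !mulr_ge0 ?invr_ge0 ?ler0n //.
    by apply: prodr_ge0 => j _; rewrite ffunE ler0n.
  rewrite big_tuple3 !big_bool /= !phipE /= !mulr0 !mulr1 !add0r.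
  by rewrite -[2^-1]mul1r -splitr.
case=> -[pi a] [_ _ _ /= sum_a] eq_phi.
have qE x y z :
    pi [tuple x] * (a [tuple x; y] * a [tuple y; z]) = 2^-1 * (~~ x && ~~ y)%:R.
  by rewrite -(phipE x y z) -eq_phi phi13E.
have half_neq0 : 2^-1 != 0 :> R by rewrite invr_eq0 pnatr_eq0.
(* The mass of (0,0,1) is [pi_0 a_00 a_01], so this one path yields both nonzero factors. *)
have : pi [tuple false] * (a [tuple false; false] * a [tuple false; true]) != 0.
  by rewrite qE mulr1.
rewrite !mulf_eq0 !negb_or => /and3P[pi0 _ a01].
have row1 z : a [tuple true; z] = 0.
  have /eqP := qE false true z.
  by rewrite mulr0 !mulf_eq0 (negPf pi0) (negPf a01) => /eqP.
have rconsE z : [tuple of rcons [tuple true] z] = [tuple true; z].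
  exact: val_inj.
have := sum_a [tuple true].
by rewrite big_bool /= !rconsE !row1 addr0 => /eqP; rewrite eq_sym oner_eq0.
Qed.
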